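(* Let $\mathcal A$ be an S-ring over a finite cyclic group $G$ that is the $U/L$-wreath product for some $\mathcal A$-section $U/L$. Suppose that either $\mathcal A_U$ is Cayley isomorphic to $\mathcal A_L\otimes\mathcal A_{U/L}$, or $\mathcal A_{G/L}$ is Cayley isomorphic to $\mathcal A_{U/L}\otimes\mathcal A_{G/U}$. Then $\mathcal A$ is schurian if and only if both $\mathcal A_U$ and $\mathcal A_{G/L}$ are schurian.
   Context: An S-ring over a finite group $G$ is a subring $\mathcal A$ of $\mathbb Z G$ spanned by the sums $\underline X=\sum_{x\in X}x$ over the blocks $X$ of a partition of $G$ (basic sets) containing $\{e\}$ and closed under $X\mapsto X^{-1}$. An $\mathcal A$-group is a subgroup that is a union of basic sets; an $\mathcal A$-section is $U/L$ with $L\le U$ $\mathcal A$-groups, with restriction $\mathcal A_{U/L}$ the S-ring over $U/L$ whose basic sets are the images of basic sets contained in $U$ (and $\mathcal A_U=\mathcal A_{U/1}$, $\mathcal A_{G/L}$ likewise). For $X\subseteq G$, $\mathrm{rad}(X)=\{g: gX=X\}$; $\mathcal A$ is the $U/L$-wreath product if $L\le\mathrm{rad}(X)$ for every basic set $X\not\subseteq U$. For S-rings $\mathcal A_1$ over $G_1$ and $\mathcal A_2$ over $G_2$, $\mathcal A_1\otimes\mathcal A_2$ is the S-ring over $G_1\times G_2$ with basic sets $X_1\times X_2$. Cayley isomorphism: a group isomorphism mapping basic sets onto basic sets. An S-ring is schurian if there is a permutation group on the underlying group containing all right translations such that the basic sets are exactly the orbits of the stabilizer of the identity. *)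

(* Defs.v *)
From HB Require Import structures.
From mathcomp Require Import all_boot all_order all_algebra all_fingroup all_solvable.

Set Implicit Arguments.
Unset Strict Implicit.
Unset Printing Implicit Defensive.

Import GRing.Theory.

Local Open Scope group_scope.

(* The integral group ring: {ffun gT -> int} with convolution as product. The
   alias is needed because {ffun gT -> int} carries the pointwise product. For
   G : {group gT}, the ring Z[G] is the subring of functions supported on G. *)
Definition int_group_ring (gT : finGroupType) : Type := {ffun gT -> int}.

Section IntGroupRing.

Variable gT : finGroupType.
Local Notation ZG := (int_group_ring gT).
Local Open Scope ring_scope.

HB.instance Definition _ := GRing.Zmodule.on ZG.

Definition igr_coef (a : ZG) (x : gT) : int := (a : {ffun gT -> int}) x.

Definition igr_one : ZG := [ffun x : gT => (x == 1%g)%:R : int].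

Definition igr_mul (a b : ZG) : ZG :=
  [ffun z : gT => \sum_(x : gT) igr_coef a x * igr_coef b (x^-1 * z)%g].

Lemma igr_mulA : associative igr_mul.
Proof.
move=> a b c; apply/ffunP=> z; rewrite !ffunE /igr_coef.
under eq_bigr => x _ do rewrite ffunE mulr_sumr.
under [RHS]eq_bigr => x _ do rewrite ffunE mulr_suml.
rewrite [RHS]exchange_big /=; apply: eq_bigr => x _.
rewrite [RHS](reindex_inj (mulgI x)) /=; apply: eq_bigr => y _.
by rewrite /igr_coef mulKg invMg mulgA mulrA.
Qed.

Lemma igr_mul1r : left_id igr_one igr_mul.
Proof.
move=> a; apply/ffunP=> z; rewrite !ffunE (bigD1 1%g) //= big1 => [|x /negPf x1].
  by rewrite /igr_coef ffunE eqxx mul1r addr0 invg1 mul1g.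
by rewrite /igr_coef ffunE x1 mul0r.
Qed.

Lemma igr_mulr1 : right_id igr_one igr_mul.
Proof.
move=> a; apply/ffunP=> z; rewrite !ffunE (bigD1 z) //= big1 => [|x xz].
  by rewrite /igr_coef ffunE mulVg eqxx mulr1 addr0.
rewrite /igr_coef ffunE -eq_mulVg1 (negPf xz) mulr0 //.
Qed.

Lemma igr_mulDl : left_distributive igr_mul +%R.
Proof.
move=> a b c; apply/ffunP=> z; rewrite !ffunE -big_split /=.
by apply: eq_bigr => x _; rewrite /igr_coef ffunE mulrDl.
Qed.

Lemma igr_mulDr : right_distributive igr_mul +%R.
Proof.
move=> a b c; apply/ffunP=> z; rewrite !ffunE -big_split /=.
by apply: eq_bigr => x _; rewrite /igr_coef ffunE mulrDr.
Qed.

Lemma igr_one_neq0 : igr_one != 0 :> ZG.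
Proof. by apply/eqP=> /ffunP/(_ 1%g); rewrite !ffunE eqxx. Qed.

HB.instance Definition _ := GRing.Zmodule_isNzRing.Build ZG
  igr_mulA igr_mul1r igr_mulr1 igr_mulDl igr_mulDr igr_one_neq0.

Definition igr_sum (X : {set gT}) : ZG := [ffun x : gT => (x \in X)%:R : int].

(* S : {set {set gT}} is the set of basic sets; the associated submodule is the
   Z-span of the sums over its members. *)
Definition in_span (S : {set {set gT}}) (a : ZG) : Prop :=
  exists c : {set gT} -> int, a = \sum_(X in S) igr_sum X *~ c X.

Definition is_subring (A : ZG -> Prop) : Prop :=
  [/\ A 1, forall a b, A a -> A b -> A (a - b)
    & forall a b, A a -> A b -> A (a * b)].

End IntGroupRing.

(* An S-ring over G is represented by its partition of G into basic sets, which
   determines it and is determined by it. *)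
Definition sring (gT : finGroupType) (G : {group gT}) (S : {set {set gT}}) : Prop :=
  [/\ partition S G, [set 1] \in S, {in S, forall X : {set gT}, X^-1 \in S}
    & is_subring (in_span S)].

Definition sring_group (gT : finGroupType) (S : {set {set gT}}) (H : {group gT}) : Prop :=
  exists2 P : {set {set gT}}, P \subset S & H = cover P :> {set gT}.

Definition sring_section (gT : finGroupType) (S : {set {set gT}}) (U L : {group gT}) : Prop :=
  [/\ sring_group S U, sring_group S L & L \subset U].

Definition sring_sub (gT : finGroupType) (S : {set {set gT}}) (U : {group gT}) :
    {set {set gT}} :=
  [set X in S | X \subset U].

(* The images X / L are the honest images of X when U normalises L, which is
   automatic in abelian groups. *)
Definition sring_quo (gT : finGroupType) (S : {set {set gT}}) (U L : {group gT}) :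
    {set {set coset_of L}} :=
  [set X / L | X : {set gT} in sring_sub S U].

Definition set_rad (gT : finGroupType) (G : {group gT}) (X : {set gT}) : {set gT} :=
  [set g in G | g *: X == X].

Definition is_wreath (gT : finGroupType) (G : {group gT}) (S : {set {set gT}})
    (U L : {group gT}) : Prop :=
  {in S, forall X : {set gT}, ~~ (X \subset U) -> L \subset set_rad G X}.

Definition sring_tensor (gT1 gT2 : finGroupType) (S1 : {set {set gT1}})
    (S2 : {set {set gT2}}) : {set {set gT1 * gT2}} :=
  [set setX X1 X2 | X1 in S1, X2 in S2].

Definition cayley_isomorphic (gT1 gT2 : finGroupType)
    (G1 : {group gT1}) (S1 : {set {set gT1}})
    (G2 : {group gT2}) (S2 : {set {set gT2}}) : Prop :=
  exists2 f : {morphism G1 >-> gT2},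
    isom G1 G2 f & [set f @* X | X : {set gT1} in S1] = S2.

Definition right_translation (gT : finGroupType) (g : gT) : {perm gT} :=
  perm (mulIg g).

(* The permutation group acts on the type [subg G] of elements of G; its orbits
   are transported to subsets of gT by sgval. *)
Definition schurian (gT : finGroupType) (G : {group gT}) (S : {set {set gT}}) : Prop :=
  exists2 Gamma : {group {perm [subg G]}},
    forall g : [subg G], right_translation g \in Gamma
    & S = [set sgval @: orbit 'P 'C_Gamma[1 | 'P] x | x : [subg G]].

(* Main.v *)
(* An S-ring is schurian iff for any x, y in a basic set some color-preserving map s
   fixes 1 and sends x to y, the color of (g, h) being the basic set of
   h g^-1.  Such maps restrict to U and descend to G / L, which is the easy
   direction.  Conversely, in a U/L-wreath product the color of a pair in
   distinct U-cosets only depends on its image in G / L, so s may be built coset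
   by coset, provided its local pieces agree modulo L with a map on G / L.
   - If A_U splits off A_L, the map s0 of G / L is lifted on each coset of U by
     prescribing, besides the image in G / L, the L-component: this component is
     moved by a map of A_L, chosen according to x and y when these lie in U.
   - If A_(G/L) splits off A_(U/L), choose representatives c of the cosets of U
     with trivial U/L-component and put s (u c) = s1 u * t c, where s1 is a map
     of A_U and t permutes the representatives as a map of A_(G/U) does. *)
Require Import Defs.
From mathcomp Require Import all_boot all_order all_algebra all_fingroup all_solvable.

Set Implicit Arguments.
Unset Strict Implicit.
Unset Printing Implicit Defensive.

Local Open Scope group_scope.

(** * Lying in a common basic set, as a relation on elements *)

Definition sim (T : finType) (S : {set {set T}}) (a b : T) : bool :=
  [exists X in S, (a \in X) && (b \in X)].

(* Equality of basic sets in the quotient S-ring modulo H, read on G. *)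
Definition simq (gT : finGroupType) (S : {set {set gT}}) (H : {set gT})
    (a b : gT) : bool :=
  [exists h in H, sim S a (b * h)].

Section Sim.

Variables (T : finType) (S : {set {set T}}).

Lemma simP a b : reflect (exists X, [/\ X \in S, a \in X & b \in X]) (sim S a b).
Proof.
apply: (iffP exists_inP) => [[X XS /andP[aX bX]]|[X [XS aX bX]]]; first by exists X.
by exists X => //; rewrite aX.
Qed.

Lemma sim_sym a b : sim S a b -> sim S b a.
Proof. by case/simP=> X [XS aX bX]; apply/simP; exists X. Qed.

Lemma sim_in (D : {set T}) a b : partition S D -> sim S a b -> a \in D /\ b \in D.
Proof.
move=> pS /simP[X [XS aX bX]].
by rewrite -(cover_partition pS); split; apply/bigcupP; exists X.
Qed.

Lemma sim_refl (D : {set T}) a : partition S D -> a \in D -> sim S a a.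
Proof.
move=> pS; rewrite -(cover_partition pS) => /bigcupP[X XS aX].
by apply/simP; exists X.
Qed.

Lemma sim_mem a b X : trivIset S -> sim S a b -> X \in S -> a \in X -> b \in X.
Proof.
move=> tS /simP[Y [YS aY bY]] XS aX.
by rewrite -(def_pblock tS XS aX) (def_pblock tS YS aY).
Qed.

Lemma sim_trans a b c : trivIset S -> sim S a b -> sim S b c -> sim S a c.
Proof.
move=> tS /simP[Y [YS aY bY]] bc; apply/simP; exists Y; split => //.
exact: sim_mem bc YS bY.
Qed.

End Sim.

(** * Schurity in terms of color-preserving maps *)

Section Schurian.

Variables (gT : finGroupType) (G : {group gT}) (S : {set {set gT}}).
Hypotheses (pS : partition S G) (S1 : [set 1] \in S).

Let tS : trivIset S := partition_trivIset pS.
Let sK : {in G, cancel (subg G) sgval} := @subgK _ G.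

Lemma sim1 a : sim S 1 a -> a = 1.
Proof. by move=> s; apply/set1P; apply: sim_mem tS s S1 (set11 1). Qed.

(** Such a map stabilizes [G], by comparing [g] with 1, and is injective on [G], because {1} is a
    basic set. *)
Definition scheme_map (s : gT -> gT) : Prop :=
  s 1 = 1 /\ {in G &, forall g h, sim S (s h * (s g)^-1) (h * g^-1)}.

Lemma scheme_map_sim s g : scheme_map s -> g \in G -> sim S (s g) g.
Proof. by case=> s1 sS gG; have:= sS 1 g (group1 G) gG; rewrite s1 invg1 !mulg1. Qed.

Lemma scheme_map_in s g : scheme_map s -> g \in G -> s g \in G.
Proof. by move=> sS gG; case: (sim_in pS (scheme_map_sim sS gG)). Qed.

(** The group of all color-preserving permutations, the witness of schurity in [schurianP]. *)
Definition scheme_aut_group : {set {perm [subg G]}} :=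
  [set p : {perm [subg G]} | [forall g, forall h,
     sim S (sgval (p h) * (sgval (p g))^-1) (sgval h * (sgval g)^-1)]].

Lemma scheme_autP (p : {perm [subg G]}) :
  reflect (forall g h, sim S (sgval (p h) * (sgval (p g))^-1) (sgval h * (sgval g)^-1))
    (p \in scheme_aut_group).
Proof.
rewrite inE; apply: (iffP forallP) => H g; first by move=> h; apply: (forallP (H g)).
by apply/forallP.
Qed.

Lemma scheme_aut_group_set : group_set scheme_aut_group.
Proof.
apply/group_setP; split=> [|p q /scheme_autP Hp /scheme_autP Hq]; apply/scheme_autP=> g h.
  by rewrite !perm1; apply: sim_refl pS _; rewrite groupM ?groupV ?subgP.
by rewrite !permM; apply: sim_trans tS (Hq _ _) (Hp _ _).
Qed.

Canonical scheme_aut_groupType := Group scheme_aut_group_set.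

Lemma schurianP :
  schurian G S <->
  (forall x y, sim S x y -> exists2 s, scheme_map s & s x = y).
Proof.
split=> [[Gam trGam defS] x y|trS].
  case/simP=> X [XS]; rewrite defS in XS; case/imsetP: (XS) => z _ -> {X XS}.
  case/imsetP=> _ /orbitP[p Cp <-] -> /imsetP[_ /orbitP[q Cq <-] ->].
  have fixC r : r \in 'C_Gam[1 | 'P] -> r \in Gam /\ r 1 = 1.
    by case/setIP=> rG /astab1P r1; split.
  have Cr : p^-1 * q \in 'C_Gam[1 | 'P] by rewrite groupM ?groupV.
  set r := _ * q in Cr; have [rG r1] := fixC _ Cr.
  exists (fun g => sgval (r (subg G g))); last first.
    by rewrite sgvalK /= /aperm /r permM permK.
  split=> [|g h gG hG]; first by rewrite morph1 r1 morph1.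
  set g' := subg G g; set h' := subg G h.
  (* Composing [r] with translations gives an element of [Gam] that fixes 1 and sends [h g^-1] to
     [r h (r g)^-1], so these two lie in one orbit of the stabilizer. *)
  pose d : {perm [subg G]} := right_translation g' * r * (right_translation (r g'))^-1.
  have tE u v : right_translation u v = v * u :> [subg G] by rewrite permE.
  have dG : d \in Gam.
    by apply: groupM; [apply: groupM; [apply: trGam|] | rewrite groupV; apply: trGam].
  have d1 : d 1 = 1.
    apply: (@perm_inj _ (right_translation (r g'))).
    by rewrite -permM mulgKV permM !tE !mul1g.
  have dv : d (h' * g'^-1) = r h' * (r g')^-1.
    apply: (@perm_inj _ (right_translation (r g'))).
    by rewrite -permM mulgKV permM !tE !mulgKV.
  apply/simP; exists (sgval @: orbit 'P 'C_Gam[1 | 'P] (h' * g'^-1)).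
  split; first by rewrite defS imset_f.
    rewrite -morphV ?inE // -morphM ?inE // -dv; apply: imset_f.
    by apply: mem_orbit; apply/setIP; split=> //; apply/astab1P.
  have -> : h * g^-1 = sgval (h' * g'^-1).
    by rewrite morphM ?inE // morphV ?inE // /g' /h' /= !sK.
  exact/imset_f/orbit_refl.
exists [group of scheme_aut_group] => [g|].
  apply/scheme_autP=> h k; rewrite !permE !morphM ?inE // invMg mulgA mulgK.
  by apply: sim_refl pS _; rewrite groupM ?groupV ?subgP.
have orbE X (x : [subg G]) : X \in S -> sgval x \in X ->
    X = sgval @: orbit 'P 'C_(scheme_aut_group)[1 | 'P] x.
  move=> XS xX; apply/setP=> y; apply/idP/imsetP => [yX|[_ /orbitP[p Cp <-] ->]].
    have /trS[s sS sx] : sim S (sgval x) y by apply/simP; exists X.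
    have [s1 sE] := sS.
    (* On [G], [s] is a permutation: equal values have color {1}, hence come from equal
       arguments. *)
    pose f (g : [subg G]) := subg G (s (sgval g)).
    have fK g : sgval (f g) = s (sgval g) by rewrite sK // (scheme_map_in sS) ?subgP.
    have injf : injective f.
      move=> g h /(congr1 sgval); rewrite !fK => e; apply: (@subg_inj _ G).
      have := sE _ _ (subgP g) (subgP h); rewrite e mulgV => /sim1 e1.
      by apply/esym/eqP; rewrite eq_mulgV1 e1.
    have f1 : f 1 = 1 by apply: (@subg_inj _ G); rewrite fK morph1 s1.
    exists (perm injf x); last by rewrite permE fK sx.
    apply: mem_orbit; apply/setIP; split; last by apply/astab1P; rewrite /= /aperm permE.
    by apply/scheme_autP=> g h; rewrite !permE !fK sE ?subgP.
  case/setIP: Cp => /scheme_autP Hp /astab1P /=; rewrite /aperm => p1.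
  have := Hp 1 x; rewrite p1 morph1 invg1 !mulg1 => /sim_sym sxp.
  exact: sim_mem tS sxp XS xX.
apply/setP=> X; apply/idP/imsetP => [XS|[x _ ->]].
  have /set0Pn[x xX] : X != set0 by apply: contraTneq XS => ->; case/and3P: pS.
  have xG : x \in G by rewrite -(cover_partition pS); apply/bigcupP; exists X.
  by exists (subg G x) => //; apply: orbE; rewrite ?sK.
have /simP[B [BS xB _]] := sim_refl pS (subgP x).
by rewrite -(orbE B).
Qed.

End Schurian.

(** * Basic sets and A-subgroups of an S-ring over an abelian group *)

Section SRing.

Variables (gT : finGroupType) (G : {group gT}) (S : {set {set gT}}).
Hypotheses (abG : abelian G) (srS : sring G S).

Lemma sring_partition : partition S G. Proof. by case: srS. Qed.

Lemma sring_trivIset : trivIset S.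
Proof. exact: partition_trivIset sring_partition. Qed.

Lemma sring_set1 : [set 1] \in S. Proof. by case: srS. Qed.

Let pS := sring_partition.
Let tS := sring_trivIset.

Lemma span_coef_const (a : int_group_ring gT) x y :
  in_span S a -> sim S x y -> igr_coef a x = igr_coef a y.
Proof.
move=> [c ->] xy; pose P (u : int_group_ring gT) := igr_coef u x = igr_coef u y.
have P0 : P 0%R by rewrite /P /igr_coef !ffunE.
have PD u v : P u -> P v -> P (u + v)%R by rewrite /P /igr_coef !ffunE => -> ->.
have PN u : P u -> P (- u)%R by rewrite /P /igr_coef !ffunE => ->.
have PMn u n : P u -> P (u *+ n)%R.
  by move=> Pu; elim: n => [|n IHn]; rewrite ?GRing.mulr0n // GRing.mulrS; apply: PD.
apply: (big_ind P) => // X XS.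
have PX : P (igr_sum X).
  rewrite /P /igr_coef !ffunE; congr (_%:R)%R; congr nat_of_bool.
  by apply/idP/idP; [apply: sim_mem tS xy XS | apply: sim_mem tS (sim_sym xy) XS].
by case: (c X) => n; [apply: PMn | apply/PN/PMn].
Qed.

Lemma span_igr_sum X : X \in S -> in_span S (igr_sum X).
Proof.
move=> XS; exists (fun Z => (Z == X)%:R%R).
rewrite (bigD1 X) //= eqxx big1 ?GRing.addr0 // => Z /andP[_ /negPf ->].
by rewrite mulr0z.
Qed.

(* The coefficient of X * Y at a counts the factorisations of a in X x Y; it is
   positive at a = x * y and constant on the basic set of a. *)
Lemma sim_mul_decomp a b x y :
  sim S a b -> x \in G -> y \in G -> a = x * y ->
  exists x' y', [/\ b = x' * y', sim S x x' & sim S y y'].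
Proof.
move=> ab xG yG aE.
have /simP[X [XS xX _]] := sim_refl pS xG; have /simP[Y [YS yY _]] := sim_refl pS yG.
have spXY : in_span S (igr_sum X * igr_sum Y)%R.
  by case: srS => _ _ _ [_ _]; apply; apply: span_igr_sum.
pose Q z u := (u \in X) && (u^-1 * z \in Y).
have coefE z : igr_coef (igr_sum X * igr_sum Y)%R z
    = (\sum_(u : gT) (Q z u)%:R)%R :> (int : Type).
  rewrite {1}/igr_coef ffunE; apply: eq_bigr => u _.
  by rewrite /igr_coef !ffunE -GRing.natrM mulnb /Q.
have := span_coef_const spXY ab; rewrite !coefE => eab.
case: (pickP (Q b)) => [u /andP[uX vY]|no].
  exists u, (u^-1 * b); rewrite mulKVg.
  by split=> //; apply/simP; [exists X | exists Y].
have : (\sum_(u : gT) (Q b u)%:R)%R = 0%R :> (int : Type).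
  by rewrite big1 // => u _; rewrite no.
rewrite -eab (bigD1 x) //= {1}/Q xX aE mulKg yY => /eqP.
rewrite -GRing.natr_sum -GRing.natrD.
by rewrite Num.Theory.pnatr_eq0.
Qed.

Lemma abelian_mulKV a x : a \in G -> x \in G -> x * (a * x^-1) = a.
Proof. by move=> aG xG; rewrite (centsP abG x xG) ?mulgKV ?groupM ?groupV. Qed.

Section Subgroup.

Variable H : {group gT}.
Hypothesis sgH : sring_group S H.

Lemma sring_group_sub : H \subset G.
Proof.
case: sgH => P sPS ->; apply/subsetP=> x /bigcupP[X XP xX].
by rewrite -(cover_partition pS); apply/bigcupP; exists X => //; apply: (subsetP sPS).
Qed.

Let sHG := sring_group_sub.

Lemma sring_group_sim a b : sim S a b -> a \in H -> b \in H.
Proof.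
case: sgH => P sPS -> ab /bigcupP[X XP aX].
by apply/bigcupP; exists X => //; apply: sim_mem tS ab (subsetP sPS _ XP) aX.
Qed.

Lemma sring_group_block X a : X \in S -> a \in X -> a \in H -> X \subset H.
Proof.
move=> XS aX aH; apply/subsetP=> b bX.
by apply: sring_group_sim aH; apply/simP; exists X.
Qed.

Lemma sring_abelian_norm : G \subset 'N(H).
Proof. exact: sub_abelian_norm abG sHG. Qed.

Let nHG := sring_abelian_norm.

Lemma coset_eqP a b : a \in G -> b \in G ->
  reflect (coset H a = coset H b) (a * b^-1 \in H).
Proof.
by move=> aG bG; rewrite -mem_rcoset; apply: rcoset_kercosetP; apply: (subsetP nHG).
Qed.

(** The factorisation [a = (a h) h^-1] is transported to [b], and the factor replacing [h^-1] stays
    in [H], a union of basic sets. This is what makes [simq] symmetric and transitive. *)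
Lemma sim_mulr a b h : sim S a b -> h \in H -> simq S H (a * h) b.
Proof.
move=> ab hH; have [aG bG] := sim_in pS ab; have hG := subsetP sHG h hH.
have [] := @sim_mul_decomp a b (a * h) h^-1; rewrite ?groupM ?groupV ?mulgK //.
move=> x [y [-> sx sy]]; apply/exists_inP; exists y^-1; last by rewrite mulgK.
by rewrite groupV (sring_group_sim sy) ?groupV.
Qed.

Lemma sim_simq a b : sim S a b -> simq S H a b.
Proof. by move=> ab; apply/exists_inP; exists 1; rewrite ?mulg1. Qed.

Lemma simqMr a b h : h \in H -> simq S H a (b * h) = simq S H a b.
Proof.
move=> hH; apply/exists_inP/exists_inP => [] [k kH sab].
  by exists (h * k); rewrite ?groupM // mulgA.
by exists (h^-1 * k); rewrite ?groupM ?groupV // -mulgA mulKVg.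
Qed.

Lemma simq_in a b : simq S H a b -> a \in G /\ b \in G.
Proof.
case/exists_inP=> h hH /(sim_in pS)[aG bhG]; split=> //.
by rewrite -(groupMr _ (subsetP sHG h hH)).
Qed.

Lemma simq_sym a b : simq S H a b -> simq S H b a.
Proof.
case/exists_inP=> h hH /sim_sym/sim_mulr/(_ (groupVr hH)).
by rewrite mulgK.
Qed.

Lemma simq_trans a b c : simq S H a b -> simq S H b c -> simq S H a c.
Proof.
case/exists_inP=> h hH sab /exists_inP[k kH /sim_mulr/(_ hH)/exists_inP[l lH sbc]].
rewrite -(simqMr _ _ kH) -(simqMr _ _ lH); apply: sim_simq.
exact: sim_trans tS sab sbc.
Qed.

Lemma simqMl a b h : h \in H -> simq S H (a * h) b = simq S H a b.
Proof.
have simqC u v : simq S H u v = simq S H v u by apply/idP/idP => /simq_sym.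
by move=> hH; rewrite simqC simqMr // simqC.
Qed.

Lemma sim_subE a b : sim (sring_sub S H) a b = (a \in H) && sim S a b.
Proof.
apply/idP/andP => [/simP[X []]|[aH /simP[X [XS aX bX]]]].
  rewrite inE => /andP[XS sXH] aX bX; split; first exact: (subsetP sXH).
  by apply/simP; exists X.
by apply/simP; exists X; split=> //; rewrite inE XS (sring_group_block XS aX).
Qed.

Lemma sring_sub_partition : partition (sring_sub S H) H.
Proof.
case/and3P: pS => covS _ nS0; apply/and3P; split.
- rewrite eqEsubset; apply/andP; split; apply/subsetP=> x.
    by case/bigcupP=> X; rewrite inE => /andP[_ /subsetP]; apply.
  move=> xH; have /simP[X [XS xX _]] := sim_refl pS (subsetP sHG x xH).
  by apply/bigcupP; exists X; rewrite // inE XS (sring_group_block XS xX).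
- by apply: trivIsetS tS; apply/subsetP=> X; rewrite inE => /andP[].
by rewrite inE negb_and nS0.
Qed.

Lemma sring_sub_set1 : [set 1] \in sring_sub S H.
Proof. by rewrite inE sring_set1 sub1set group1. Qed.

End Subgroup.

(** * The quotient S-ring, read on representatives *)

Section Quotient.

Variables U H : {group gT}.
Hypotheses (sgU : sring_group S U) (sgH : sring_group S H).

Let sUG := sring_group_sub sgU.
Let nHG := sring_abelian_norm sgH.
Let nHU := subset_trans sUG nHG.

(** Elements of [X / H] have representatives in [X], and [simq] absorbs factors from [H] on both
    sides. *)
Lemma sim_quoE a b : a \in U -> b \in U ->
  sim (sring_quo S U H) (coset H a) (coset H b) = simq S H a b.
Proof.
move=> aU bU; have [aG bG] := (subsetP sUG a aU, subsetP sUG b bU).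
apply/idP/idP => [/simP[_ [/imsetP[X XSU ->]]]|/exists_inP[h hH /simP[X [XS aX bX]]]].
  move: XSU; rewrite inE => /andP[XS sXU].
  case/morphimP=> x _ xX /(coset_eqP sgH aG) ax /morphimP[y _ yX] /(coset_eqP sgH bG) byy.
  have xG := subsetP sUG x (subsetP sXU x xX).
  have yG := subsetP sUG y (subsetP sXU y yX).
  rewrite -(abelian_mulKV aG xG) -(abelian_mulKV bG yG).
  rewrite simqMl ?simqMr ?ax ?byy //; apply: sim_simq => //.
  by apply/simP; exists X.
have sXU := sring_group_block sgU XS aX aU.
apply/simP; exists (X / H); split.
- by apply: imset_f; rewrite inE XS.
- by apply: mem_morphim => //; apply: (subsetP nHG).
have <- : coset H (b * h) = coset H b by rewrite coset_kerr.
by apply: mem_morphim => //; apply: (subsetP nHU); apply: (subsetP sXU).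
Qed.

Lemma sring_quo_partition : partition (sring_quo S U H) (U / H).
Proof.
have liftU C : C \in U / H -> exists2 u, u \in U & C = coset H u.
  by case/morphimP=> u _ uU ->; exists u.
have sub X : X \in sring_quo S U H -> X \subset U / H.
  by case/imsetP=> Y; rewrite inE => /andP[_ sYU] ->; apply: quotientS.
apply/and3P; split.
- rewrite eqEsubset; apply/andP; split.
    by apply/bigcupsP=> X /sub.
  apply/subsetP=> C /liftU[u uU ->].
  have := sim_quoE uU uU; rewrite (sim_simq H (sim_refl pS (subsetP sUG u uU))).
  by case/simP=> X [XS uX _]; apply/bigcupP; exists X.
- apply/trivIsetP=> X Y XS YS; apply: contraR => /pred0Pn[C /andP[/= CX CY]].
  (* If [C] is common to both images, a representative [y] of [C] in the second basic set is
     [simq]-related to a representative [d] of any [D] in the first image; so [d h] is in the second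
     basic set for some [h] in [H]. *)
  suff half X' Y' : X' \in sring_quo S U H -> Y' \in sring_quo S U H ->
      C \in X' -> C \in Y' -> X' \subset Y'.
    by rewrite eqEsubset !half.
  move=> X'S Y'S CX' CY'; apply/subsetP=> D DX'.
  have [c cU cE] := liftU C (subsetP (sub _ X'S) _ CX').
  have [d dU dE] := liftU D (subsetP (sub _ X'S) _ DX').
  have : sim (sring_quo S U H) C D by apply/simP; exists X'.
  rewrite cE dE sim_quoE // => cd.
  case/imsetP: Y'S => Y0; rewrite inE => /andP[Y0S sY0U] Y'E.
  move: CY'; rewrite Y'E cE => /morphimP[y _ yY0 /(coset_eqP sgH (subsetP sUG c cU)) cy].
  have yU := subsetP sY0U y yY0.
  have : simq S H y d.
    apply: simq_trans cd => //; rewrite -(simqMl sgH _ _ (cy (subsetP sUG y yU))).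
    rewrite abelian_mulKV ?(subsetP sUG) //.
    exact/sim_simq/(sim_refl pS)/(subsetP sUG).
  case/exists_inP=> h hH yd.
  have dY : d * h \in Y0 := sim_mem tS yd Y0S yY0.
  rewrite -(coset_kerr d hH); apply: mem_morphim => //.
  by apply: (subsetP nHU); apply: (subsetP sY0U).
apply/imsetP=> [[X XS /esym/eqP]]; rewrite -subset0 => X0.
move: XS; rewrite inE => /andP[XS sXU].
have /set0Pn[x xX] : X != set0 by apply: contraTneq XS => ->; case/and3P: pS.
have : coset H x \in X / H.
  by apply: mem_morphim => //; apply: (subsetP nHU); apply: (subsetP sXU).
by move/(subsetP X0); rewrite inE.
Qed.

Lemma sring_quo_set1 : [set 1] \in sring_quo S U H.
Proof.
apply/imsetP; exists [set 1]; first exact: sring_sub_set1.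
by rewrite /= quotient1.
Qed.

End Quotient.

End SRing.

(** * The first coordinate of a tensor decomposition *)

(** Here [f] is the first coordinate of the isomorphism, which sends [K] into [B1 x 1]. So a factor
    from [K] does not affect second coordinates: if [a] and [b k] share a basic set, then so do the
    second coordinates of [a] and [b], and the product of this block with one containing [f a] and
    [f b] pulls back to a basic set of [S0]. *)
Lemma tensor_iso (aT T1 T2 : finGroupType) (A K : {group aT}) (B1 : {group T1})
    (B2 : {group T2}) (S0 : {set {set aT}}) (S1 : {set {set T1}}) (S2 : {set {set T2}}) :
  cyclic A -> K \subset A -> #|K| = #|B1| -> partition S0 A ->
  cayley_isomorphic A S0 (setX_group B1 B2) (sring_tensor S1 S2) ->
  exists f : aT -> T1,
    [/\ {in A &, {morph f : a b / a * b}}, f @: A \subset B1,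
        {in K, forall k, f k = 1 -> k = 1},
        forall a b, sim S0 a b -> sim S1 (f a) (f b)
      & forall a b k, a \in A -> b \in A -> k \in K ->
          sim S0 a (b * k) -> sim S1 (f a) (f b) -> sim S0 a b].
Proof.
move=> cycA sKA cardK pS0 [f /isomP[injf imf] fS].
have memf a X : a \in A -> X \in S0 -> f a \in f @* X -> a \in X.
  move=> aA XS /morphimP[b bA bX /(injmP injf)-> //].
have fA a : a \in A -> f a \in setX B1 B2 by rewrite -imf => aA; apply: mem_morphim.
have fK k : k \in K -> (f k).2 = 1.
  (* A cyclic group has a single subgroup of order #|K|. *)
  pose K' := (f @*^-1 (setX_group B1 1%G))%G.
  have sXB : setX B1 1 \subset setX B1 B2 by rewrite setXS ?sub1G.
  have cardK' : #|K'| = #|K|.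
    rewrite cardK -(card_injm injf) ?subsetIl // morphpreK ?imf //.
    by rewrite cardsX cards1 muln1.
  have /eqP-> : K == K' :> {set aT} by rewrite (eq_subG_cyclic cycA) ?cardK' ?subsetIl.
  by case/morphpreP=> _; rewrite inE => /andP[_ /set1P].
exists (fun a => (f a).1); split.
- by move=> a b aA bA; rewrite morphM.
- by apply/subsetP=> _ /imsetP[a /fA aA ->]; move: aA; rewrite inE => /andP[].
- move=> k kK fk1; apply: (injmP injf); rewrite ?group1 ?(subsetP sKA) //.
  by rewrite morph1 [f k]surjective_pairing fk1 fK.
- move=> a b sab; have [aA bA] := sim_in pS0 sab; case/simP: sab => X [XS aX bX].
  have : f @* X \in sring_tensor S1 S2 by rewrite -fS; apply: imset_f.
  case/imset2P=> X1 X2 X1S _ fX.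
  have: f a \in f @* X by apply: mem_morphim.
  have: f b \in f @* X by apply: mem_morphim.
  rewrite fX !inE => /andP[bX1 _] /andP[aX1 _].
  by apply/simP; exists X1.
move=> a b k aA bA kK /simP[X [XS aX bkX]] /simP[Y1 [Y1S aY1 bY1]].
have kA := subsetP sKA k kK.
have : f @* X \in sring_tensor S1 S2 by rewrite -fS; apply: imset_f.
case/imset2P=> X1 X2 X1S X2S fX.
have: f a \in f @* X by apply: mem_morphim.
have: f (b * k) \in f @* X by apply: mem_morphim; rewrite ?groupM.
have bk2 : (f (b * k)).2 = (f b).2.
  by rewrite morphM //; change ((f b).2 * (f k).2 = (f b).2); rewrite (fK k kK) mulg1.
rewrite fX !inE bk2 => /andP[_ bX2] /andP[_ aX2].
have : setX Y1 X2 \in sring_tensor S1 S2 by apply: imset2_f.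
rewrite -fS => /imsetP[Z ZS ZE]; apply/simP; exists Z; split=> //.
  by apply: memf => //; rewrite -ZE inE aY1.
by apply: memf => //; rewrite -ZE inE bY1.
Qed.

(** * Color-preserving maps of subgroups and quotients *)

Section Sections.

Variables (gT : finGroupType) (G U L : {group gT}) (S : {set {set gT}}).
Hypotheses (abG : abelian G) (srS : sring G S).
Hypotheses (sgU : sring_group S U) (sgL : sring_group S L) (sLU : L \subset U).

Let pS := sring_partition srS.
Let tS := sring_trivIset srS.
Let sUG := sring_group_sub srS sgU.
Let sLG := sring_group_sub srS sgL.

Lemma sring_group_full : sring_group S G.
Proof. by exists S => //; rewrite (cover_partition pS). Qed.

Let sgG := sring_group_full.

Lemma simq_of_mem H a b : sring_group S H -> a \in H -> b \in H -> simq S H a b.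
Proof.
move=> sgH aH bH; apply/exists_inP; exists (b^-1 * a); rewrite ?groupM ?groupV //.
by rewrite mulKVg; apply/(sim_refl pS)/(subsetP (sring_group_sub srS sgH)).
Qed.

Lemma simqS a b : simq S L a b -> simq S U a b.
Proof.
by case/exists_inP=> l lL ab; apply/exists_inP; exists l; rewrite ?(subsetP sLU).
Qed.

Lemma coset_div H a b : sring_group S H -> a \in G -> b \in G ->
  coset H (a * b^-1) = coset H a * (coset H b)^-1.
Proof.
move=> sgH aG bG; have nHG := subsetP (sring_abelian_norm abG srS sgH).
by rewrite morphM ?morphV ?groupV ?nHG.
Qed.

Lemma simq_div H a b a' b' z : sring_group S H ->
    a \in G -> b \in G -> a' \in G -> b' \in G ->
    coset H a' = coset H a -> coset H b' = coset H b ->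
  simq S H (a * b^-1) z -> simq S H (a' * b'^-1) z.
Proof.
move=> sgH aG bG a'G b'G aE bE.
have eqc : coset H (a' * b'^-1) = coset H (a * b^-1) by rewrite !coset_div ?aE ?bE.
have wG : a * b^-1 \in G by rewrite groupM ?groupV.
have w'G : a' * b'^-1 \in G by rewrite groupM ?groupV.
move/(coset_eqP abG srS sgH w'G wG): eqc => eqc.
by move=> sz; rewrite -(abelian_mulKV abG w'G wG) (simqMl srS sgH).
Qed.

Lemma repr_quo_in C : C \in G / L -> repr C \in G.
Proof.
case/morphimP=> g Ng gG ->; have := mem_repr_coset (coset L g).
by rewrite val_coset // => /rcosetP[l lL ->]; rewrite groupM // (subsetP sLG).
Qed.

Lemma schurian_sub : schurian G S -> schurian U (sring_sub S U).
Proof.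
move/(schurianP pS (sring_set1 srS)) => trS.
apply/(schurianP (sring_sub_partition srS sgU) (sring_sub_set1 srS _)) => x y.
rewrite (sim_subE srS sgU) // => /andP[xU /trS[s sS sx]]; exists s => //.
case: (sS) => s1 sE; split=> // g h gU hU; rewrite (sim_subE srS sgU).
have ss : sim S (s h * (s g)^-1) (h * g^-1) by rewrite sE ?(subsetP sUG).
by rewrite ss (sring_group_sim srS sgU (sim_sym ss)) ?groupM ?groupV.
Qed.

Lemma schurian_quo : schurian G S -> schurian (G / L) (sring_quo S G L).
Proof.
move/(schurianP pS (sring_set1 srS)) => trS.
have pQ := sring_quo_partition abG srS sgG sgL.
apply/(schurianP pQ (sring_quo_set1 srS _ _)) => x y sxy.
have [xG yG] := sim_in pQ sxy.
move: sxy; rewrite -{1}[x]coset_reprK -{1}[y]coset_reprK.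
rewrite (sim_quoE abG srS sgG sgL) ?repr_quo_in //.
case/exists_inP=> l lL /trS[s sS sx]; have [s1 sE] := sS.
(* The representative of the trivial coset is 1, so the induced map fixes it; the factor [l]
   disappears modulo [L]. *)
exists (fun C : coset_of L => coset L (s (repr C))).
  split=> [|g h gG hG]; first by rewrite repr_coset1 s1 coset_id.
  have [gR hR] := (repr_quo_in gG, repr_quo_in hG).
  rewrite -coset_div ?(scheme_map_in pS sS) //.
  rewrite -{2}[g]coset_reprK -{2}[h]coset_reprK -coset_div //.
  rewrite (sim_quoE abG srS sgG sgL) ?groupM ?groupV ?(scheme_map_in pS sS) //.
  exact/sim_simq/sE.
by rewrite /= sx coset_kerr // coset_reprK.
Qed.

Hypothesis schU : schurian U (sring_sub S U).

Lemma schurian_sub_map x y : x \in U -> sim S x y ->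
  exists s : gT -> gT, [/\ s 1 = 1, s x = y, {in U, forall g, sim S (s g) g}
    & {in U &, forall g h, sim S (s h * (s g)^-1) (h * g^-1)}].
Proof.
move=> xU sxy.
have pU := sring_sub_partition srS sgU.
have /(schurianP pU (sring_sub_set1 srS _)) trU := schU.
have [] := trU x y; first by rewrite (sim_subE srS sgU) ?xU.
move=> s sS sx; have [s1 sE] := sS; exists s; split=> // [g gU|g h gU hU].
  by have := scheme_map_sim sS gU; rewrite (sim_subE srS sgU) // => /andP[].
by have := sE g h gU hU; rewrite (sim_subE srS sgU) // => /andP[].
Qed.

Hypothesis schQ : schurian (G / L) (sring_quo S G L).

(** A map of the quotient lifted to [G] through [repr]: its values, and hence their colors, are
    controlled modulo [L] only. *)
Lemma schurian_quo_map x y : sim S x y ->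
  exists s : gT -> gT, [/\ s 1 = 1, coset L (s x) = coset L y,
    {in G, forall g, s g \in G}
    & {in G &, forall g h, simq S L (s h * (s g)^-1) (h * g^-1)}].
Proof.
move=> sxy; have [xG yG] := sim_in pS sxy.
have pQ := sring_quo_partition abG srS sgG sgL.
have /(schurianP pQ (sring_quo_set1 srS _ _)) trQ := schQ.
have [] := trQ (coset L x) (coset L y).
  by rewrite (sim_quoE abG srS sgG sgL) // sim_simq.
move=> s sS sx; have [s1 sE] := sS; exists (fun g => repr (s (coset L g))).
have sG g : g \in G -> repr (s (coset L g)) \in G.
  by move=> gG; rewrite repr_quo_in // (scheme_map_in pQ sS) // mem_quotient.
split=> // [||g h gG hG]; first by rewrite coset_id // s1 repr_coset1.
  by rewrite coset_reprK sx.
rewrite -(sim_quoE abG srS sgG sgL) ?groupM ?groupV ?sG // !coset_div ?sG //.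
by rewrite !coset_reprK sE // mem_quotient.
Qed.

End Sections.

(** * Normalized coset representatives *)

Section CosetRep.

Variables (gT : finGroupType) (U : {group gT}) (P : pred gT).

(** The representative of [U] is 1, so that a map glued along cosets can fix 1. On other cosets [P]
    expresses a preference: being a prescribed point in one case, having trivial [U / L]-component
    in the other. *)
Definition coset_rep (g : gT) : gT :=
  if 1 \in U :* g then 1 else odflt (repr (U :* g)) [pick z in U :* g | P z].

Lemma coset_rep_in g : g * (coset_rep g)^-1 \in U.
Proof.
rewrite -groupV invMg invgK -mem_rcoset /coset_rep; case: ifP => // _.
by case: pickP => [z /andP[]//|_] /=; apply: mem_repr_rcoset.
Qed.

Lemma coset_rep_eq g h : h * g^-1 \in U -> coset_rep h = coset_rep g.
Proof. by rewrite -mem_rcoset /coset_rep => /rcoset_eqP ->. Qed.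

Lemma coset_rep1 g : g \in U -> coset_rep g = 1.
Proof. by move=> gU; rewrite /coset_rep mem_rcoset mul1g groupV gU. Qed.

Lemma coset_repP g z : (g \in U -> P 1) -> z * g^-1 \in U -> P z -> P (coset_rep g).
Proof.
move=> P1 zU Pz; rewrite /coset_rep; case: ifP => [|_].
  by rewrite mem_rcoset mul1g groupV => /P1.
by case: pickP => [t /andP[]//|/(_ z)]; rewrite mem_rcoset zU Pz.
Qed.

Lemma coset_rep_group (G : {group gT}) g : U \subset G -> g \in G -> coset_rep g \in G.
Proof.
move=> /subsetP sUG gG; have := sUG _ (coset_rep_in g).
by rewrite groupMl // groupV.
Qed.

Lemma coset_rep_nontriv g : coset_rep g = 1 -> g \in U.
Proof. by have:= coset_rep_in g => /[swap] ->; rewrite invg1 mulg1. Qed.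

End CosetRep.

(** * Gluing maps in a wreath product *)

Section Wreath.

Variables (gT : finGroupType) (G U L : {group gT}) (S : {set {set gT}}).
Hypotheses (abG : abelian G) (srS : sring G S).
Hypotheses (sgU : sring_group S U) (sgL : sring_group S L) (sLU : L \subset U).
Hypothesis wrS : is_wreath G S U L.
Hypothesis schU : schurian U (sring_sub S U).
Hypothesis schQ : schurian (G / L) (sring_quo S G L).

Let pS := sring_partition srS.
Let tS := sring_trivIset srS.
Let sUG := sring_group_sub srS sgU.
Let sLG := sring_group_sub srS sgL.
Let inUG a (aU : a \in U) : a \in G := subsetP sUG a aU.
Let inLG a (aL : a \in L) : a \in G := subsetP sLG a aL.
Let inLU a (aL : a \in L) : a \in U := subsetP sLU a aL.

(** The basic set of [b] has [L] in its radical, so it contains the whole coset of [b] modulo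
    [L]. *)
Lemma wreath_sim a b : b \notin U -> simq S L a b -> sim S a b.
Proof.
move=> bU /exists_inP[l lL abl]; apply: (sim_trans tS abl).
have [_ blG] := sim_in pS abl.
have bG : b \in G by rewrite -(groupMr _ (inLG lL)).
have /simP[X [XS bX _]] := sim_refl pS bG.
have nXU : ~~ (X \subset U) by apply: contra bU => /subsetP; apply.
have /subsetP/(_ l lL) := wrS XS nXU; rewrite inE => /andP[_ /eqP rX].
apply/simP; exists X; split=> //.
by rewrite (centsP abG b bG l (inLG lL)) -rX mem_lcoset mulKg.
Qed.

Lemma scheme_map_glue s :
    s 1 = 1 ->
    {in G &, forall g h, h * g^-1 \in U -> sim S (s h * (s g)^-1) (h * g^-1)} ->
    {in G &, forall g h, h * g^-1 \notin U -> simq S L (s h * (s g)^-1) (h * g^-1)} ->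
  scheme_map G S s.
Proof.
move=> s1 sU sO; split=> // g h gG hG.
have [hgU|hgU] := boolP (h * g^-1 \in U); first exact: sU.
exact: wreath_sim hgU (sO g h gG hG hgU).
Qed.


Lemma schurian_of_maps :
  (forall x y, sim S x y -> exists2 s, scheme_map G S s & s x = y) -> schurian G S.
Proof. by move/(schurianP pS (sring_set1 srS)). Qed.

Lemma coset_eq_sub a b : a \in G -> b \in G ->
  coset L a = coset L b -> coset U a = coset U b.
Proof.
move=> aG bG /(coset_eqP abG srS sgL aG bG)/inLU abU.
exact/(coset_eqP abG srS sgU aG bG).
Qed.

Lemma simq_mem_section a b : simq S L a b -> b \in U -> a \in U.
Proof.
move/(simq_sym srS sgL)=> /exists_inP[l lL /(sring_group_sim srS sgU) ba] bU.
by rewrite -(groupMr _ (inLU lL)) ba.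
Qed.

(** * The case where A_U splits off A_L *)

Section LeftSplit.

(** [f] stands for the [L]-component on [U]. Together with the class modulo [L] it determines the
    basic set of an element of [U]. *)
Variable f : gT -> gT.
Hypotheses (fM : {in U &, {morph f : a b / a * b}}) (fUL : f @: U \subset L).
Hypothesis fL1 : {in L, forall l, f l = 1 -> l = 1}.
Hypothesis f_sim : forall a b, a \in U -> sim S a b -> sim S (f a) (f b).
Hypothesis sim_f : forall a b, a \in U -> b \in U ->
  simq S L a b -> sim S (f a) (f b) -> sim S a b.

Let fU a (aU : a \in U) : f a \in L := subsetP fUL _ (imset_f f aU).

Let f1 : f 1 = 1.
Proof. by apply: (mulgI (f 1)); rewrite -fM ?mulg1. Qed.

Let fD a b : a \in U -> b \in U -> f (a * b^-1) = f a * (f b)^-1.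
Proof.
move=> aU bU; apply: (mulIg (f b)); rewrite mulgKV -fM ?groupM ?groupV //.
by rewrite mulgKV.
Qed.

(** An injective map of the finite group [L] into itself is onto. *)
Let fL_surj b : b \in L -> exists2 l, l \in L & f l = b.
Proof.
move=> bL; have injfL : {in L &, injective f}.
  move=> a c aL cL e; apply/eqP; rewrite eq_mulgV1; apply/eqP/fL1.
    by rewrite groupM ?groupV.
  by rewrite fD ?inLU // e mulgV.
have : b \in f @: L.
  suff -> : f @: L = L by [].
  apply/eqP; rewrite eqEcard card_in_imset // leqnn andbT.
  by apply/subsetP=> _ /imsetP[l lL ->]; apply/fU/inLU.
by case/imsetP=> l lL ->; exists l.
Qed.

Lemma schurian_left_split : schurian G S.
Proof.
apply: schurian_of_maps => x y sxy; have [xG yG] := sim_in pS sxy.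
have [s0 [s01 s0x s0G s0E]] := schurian_quo_map abG srS sgL schQ sxy.
(* [al] is the map moving [L]-components. For [x] in [U] it is a map of A_U sending [f x] to [f y];
   it preserves [L], a union of basic sets. *)
have [al [al1 alL alE alx]] : exists al, [/\ al 1 = 1, {in L, forall m, al m \in L},
    {in L &, forall g h, sim S (al h * (al g)^-1) (h * g^-1)}
  & x \in U -> al (f x) = f y].
  have [xU|xU] := boolP (x \in U); last first.
    exists id; split=> // g h gL hL.
    by apply: (sim_refl pS); rewrite groupM ?groupV ?inLG.
  have fxL := fU xU.
  have [al [al1 alx als alE]] := schurian_sub_map srS sgU schU (inLU fxL) (f_sim xU sxy).
  exists al; split=> // [m mL|g h gL hL]; last by rewrite alE ?inLU.
  by rewrite (sring_group_sim srS sgL (sim_sym (als m (inLU mL)))).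
(* If [x] is outside [U], its coset is represented by [x] itself. *)
pose c := coset_rep U (pred1 x).
have cU g : g * (c g)^-1 \in U := coset_rep_in U (pred1 x) g.
have cG g (gG : g \in G) : c g \in G := coset_rep_group (pred1 x) sUG gG.
(* [t] equals [s0] modulo [L], with exact values imposed at 1 and [x]. It provides the origins from
   which the [L]-components of the images are measured. *)
pose t z := if z == 1 then 1 else if z == x then y else s0 z.
have tG z : z \in G -> t z \in G.
  by move=> zG; rewrite /t; case: ifP => // _; case: ifP => // _; apply: s0G.
have tL z : z \in G -> coset L (t z) = coset L (s0 z).
  move=> zG; rewrite /t; case: eqP => [->|_]; first by rewrite s01.
  by case: eqP => [->|_].
have s0U g h : g \in G -> h \in G -> h * g^-1 \in U -> s0 h * (s0 g)^-1 \in U.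
  by move=> gG hG; apply/simq_mem_section/s0E.
have wU g : g \in G -> s0 g * (t (c g))^-1 \in U.
  move=> gG; apply/(coset_eqP abG srS sgU); rewrite ?s0G ?tG ?cG //.
  rewrite (coset_eq_sub _ _ (tL (c g) _)) ?tG ?s0G ?cG //.
  by apply/(coset_eqP abG srS sgU); rewrite ?s0G ?cG // s0U ?cG.
have /fin_all_exists[s sP] : forall g, exists h, g \in G ->
    [/\ h \in G, coset L h = coset L (s0 g), h * (t (c g))^-1 \in U
      & f (h * (t (c g))^-1) = al (f (g * (c g)^-1))].
  move=> g; have [gG|_] := boolP (g \in G); last by exists 1.
  (* Multiplying [s0 g] by [l] corrects its [L]-component and keeps its class modulo [L]. *)
  have [l lL fl] : exists2 l, l \in L &
      f l = al (f (g * (c g)^-1)) * (f (s0 g * (t (c g))^-1))^-1.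
    by apply: fL_surj; rewrite groupM ?groupV ?alL ?fU ?wU ?cU.
  exists (l * s0 g) => _; split.
  - by rewrite groupM ?s0G // (inLG lL).
  - by rewrite coset_kerl.
  - by rewrite -mulgA groupM ?wU // (inLU lL).
  - by rewrite -mulgA fM ?wU ?(inLU lL) // fl mulgKV.
have t1 : t 1 = 1 by rewrite /t eqxx.
have [s1G s1L s1U fs1] := sP 1 (group1 G); have [sxG sxL sxU fsx] := sP x xG.
have c1 : c 1 = 1 := coset_rep1 (pred1 x) (group1 U).
rewrite c1 t1 invg1 !mulg1 f1 al1 in s1U fs1.
exists s.
  apply: scheme_map_glue => [|g h gG hG hgU|g h gG hG _].
  - have : s 1 * 1^-1 \in L by apply/(coset_eqP abG srS sgL); rewrite // s1L s01.
    by rewrite invg1 mulg1 => s1_L; apply: fL1 fs1.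
  - have [hsG hsL hsU fhs] := sP h hG; have [gsG gsL gsU fgs] := sP g gG.
    have ce : c h = c g := coset_rep_eq (pred1 x) hgU.
    have sE : s h * (s g)^-1 = (s h * (t (c h))^-1) * (s g * (t (c g))^-1)^-1.
      by rewrite ce invMg invgK mulgA mulgKV.
    have hgE : h * g^-1 = (h * (c h)^-1) * (g * (c g)^-1)^-1.
      by rewrite ce invMg invgK mulgA mulgKV.
    (* Within a coset of [U] the color is preserved modulo [L] by [s0], and in the [L]-component by
       [al], since the origins cancel. *)
    apply: sim_f => //; first by rewrite sE groupM ?groupV.
      by apply: (simq_div abG srS sgL (s0G h hG) (s0G g gG)) => //; apply: s0E.
    rewrite sE hgE (fD hsU gsU) (fD (cU h) (cU g)) fhs fgs; apply: alE; exact/fU/cU.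
  have [hsG hsL _ _] := sP h hG; have [gsG gsL _ _] := sP g gG.
  by apply: (simq_div abG srS sgL (s0G h hG) (s0G g gG)) => //; apply: s0E.
(* [s x] and [y] agree modulo [L]. Their [L]-components agree as well: by [al (f x) = f y] if [x] is
   in [U], and otherwise because [y] is the origin [t (c x)]. *)
have syL : s x * y^-1 \in L by apply/(coset_eqP abG srS sgL); rewrite // sxL.
apply/eqP; rewrite eq_mulgV1; apply/eqP/fL1 => //.
have [xU|xU] := boolP (x \in U).
  have yU := sring_group_sim srS sgU sxy xU.
  have cx : c x = 1 := coset_rep1 (pred1 x) xU.
  rewrite cx t1 invg1 !mulg1 in sxU fsx.
  by rewrite fD // fsx alx // mulgV.
have cx : c x = x.
  apply/eqP; apply: (@coset_repP _ U (pred1 x) x x) => /=; rewrite ?mulgV ?eqxx //.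
  by rewrite (negPf xU).
have x1 : x == 1 = false by apply: contraNF xU => /eqP->.
by move: fsx; rewrite cx /t x1 eqxx mulgV f1 al1.
Qed.

End LeftSplit.

(** * The case where A_(G/L) splits off A_(U/L) *)

Section RightSplit.

(** [f] stands for the [U / L]-component on [G] and [E] for lying in one basic set of A_(U/L).
    Modulo [L], colors are determined by [f] and the class modulo [U]. *)
Variables (rT : finGroupType) (f : gT -> rT) (E : rel rT).
Hypotheses (fM : {in G &, {morph f : a b / a * b}}) (fL : {in L, forall l, f l = 1}).
Hypothesis f_surj : {in G, forall g, exists2 u, u \in U & f u = f g}.
Hypothesis f_simq : forall a b, simq S L a b -> E (f a) (f b).
Hypothesis simq_f : forall a b, a \in G -> b \in G ->
  simq S U a b -> E (f a) (f b) -> simq S L a b.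

Let fD a b : a \in G -> b \in G -> f (a * b^-1) = f a * (f b)^-1.
Proof.
move=> aG bG; apply: (mulIg (f b)); rewrite mulgKV -fM ?groupM ?groupV //.
by rewrite mulgKV.
Qed.

Let P : pred gT := fun z => f z == 1.
Let c := coset_rep U P.

Let cU g : g * (c g)^-1 \in U. Proof. exact: coset_rep_in. Qed.

Let cG g : g \in G -> c g \in G. Proof. exact: coset_rep_group. Qed.

Let c_coset g : g \in G -> coset U (c g) = coset U g.
Proof. by move=> gG; apply/esym/(coset_eqP abG srS sgU); rewrite ?cG. Qed.

(** If [u] in [U] has the same component as [g], then [u^-1 g] lies in the coset of [g] and has
    trivial component. *)
Let fc g : g \in G -> f (c g) = 1.
Proof.
move=> gG; have [u uU fu] := f_surj gG; apply/eqP.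
apply: (@coset_repP _ U P g (u^-1 * g)) => [_||]; first by rewrite /P fL.
  by rewrite mulgK groupV.
have uG := inUG uU.
by rewrite /P fM ?groupV // -fu -fM ?groupV // mulVg fL.
Qed.

Lemma schurian_right_split : schurian G S.
Proof.
apply: schurian_of_maps => x y sxy; have [xG yG] := sim_in pS sxy.
have [s0 [s01 s0x s0G s0E]] := schurian_quo_map abG srS sgL schQ sxy.
(* Split [y] as [w d], with [w] the target of [x (c x)^-1] and [d] that of [c x]. For [x] in [U] the
   representative 1 must be fixed, so [d = 1]. Otherwise start from [y (c y)^-1] and [c y], and
   shift a factor [l] of [L] between them to put [w] in the right basic set exactly, not only modulo
   [L]. *)
have [w [d [[wU dG yE] [uw fd dU xd]]]] : exists w d, [/\ w \in U, d \in G & y = w * d] /\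
    [/\ sim S (x * (c x)^-1) w, f d = 1, coset U d = coset U y & x \in U -> d = 1].
  have [xU|xU] := boolP (x \in U).
    have yU := sring_group_sim srS sgU sxy xU.
    exists y, 1; rewrite mulg1 fL // /c coset_rep1 // invg1 mulg1.
    by split; split=> //; rewrite !coset_id.
  have : simq S L (x * (c x)^-1) (y * (c y)^-1).
    apply: simq_f; rewrite ?groupM ?groupV ?cG //.
      exact: (simq_of_mem srS sgU).
    by rewrite !fD ?cG // !fc // invg1 !mulg1; apply/f_simq/sim_simq.
  case/exists_inP=> l lL uw; have lG := inLG lL; have lU := inLU lL.
  exists (y * (c y)^-1 * l), (l^-1 * c y); split; split=> //.
  - by rewrite groupM.
  - by rewrite groupM ?groupV ?cG.
  - by rewrite mulgA mulgK mulgKV.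
  - by rewrite fM ?groupV ?cG // fc // fL ?groupV // mulg1.
  - by rewrite coset_kerl ?groupV // c_coset.
have uU := cU x; have [s1 [s11 s1x s1s s1E]] := schurian_sub_map srS sgU schU uU uw.
have s1U g : g \in U -> s1 g \in U.
  by move=> gU; apply: (sring_group_sim srS sgU (sim_sym (s1s g gU))).
(* s x is to be y, not merely an element of the right coset modulo L. *)
pose t z := if z == c x then d else c (s0 z).
have tG z : z \in G -> t z \in G.
  by move=> zG; rewrite /t; case: ifP => // _; apply/cG/s0G.
have ft z : z \in G -> f (t z) = 1.
  by move=> zG; rewrite /t; case: ifP => // _; apply/fc/s0G.
have s0U g h : g \in G -> h \in G -> h * g^-1 \in U -> coset U (s0 h) = coset U (s0 g).
  move=> gG hG hgU; apply/(coset_eqP abG srS sgU); rewrite ?s0G //.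
  exact: simq_mem_section (s0E g h gG hG) hgU.
have s0xU : coset U (s0 x) = coset U y by apply: coset_eq_sub => //; apply: s0G.
have tc g : g \in G -> coset U (t (c g)) = coset U (s0 g).
  move=> gG; rewrite (s0U (c g) g) ?cG ?cU // /t; case: eqP => [cgx|_].
    by rewrite cgx dU -s0xU (s0U (c x) x) ?cG ?cU.
  by rewrite c_coset ?s0G ?cG.
have t1 : t 1 = 1.
  rewrite /t; case: eqP => [cx1|_]; last by rewrite s01 /c coset_rep1.
  by apply: xd; apply: (@coset_rep_nontriv _ U P); rewrite -/c.
(* [s] agrees with [s0] modulo [U] only; its [U / L]-component comes from [s1]. *)
pose s g := s1 (g * (c g)^-1) * t (c g).
have sG g : g \in G -> s g \in G.
  by move=> gG; rewrite groupM ?tG ?cG // inUG ?s1U ?cU.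
have s_coset g : g \in G -> coset U (s g) = coset U (s0 g).
  by move=> gG; rewrite coset_kerl ?tc // s1U.
have fs g : g \in G -> f (s g) = f (s1 (g * (c g)^-1)).
  by move=> gG; rewrite fM ?tG ?cG ?ft ?cG ?mulg1 // inUG ?s1U ?cU.
have fu g : g \in G -> f g = f (g * (c g)^-1).
  by move=> gG; rewrite fD ?cG // fc // invg1 mulg1.
exists s; last by rewrite /s s1x /t eqxx.
apply: scheme_map_glue => [|g h gG hG hgU|g h gG hG _].
- by rewrite /s /c coset_rep1 // invg1 mulg1 s11 t1 mulg1.
- have ce : c h = c g := coset_rep_eq P hgU.
  have -> : h * g^-1 = (h * (c h)^-1) * (g * (c g)^-1)^-1.
    by rewrite ce invMg invgK mulgA mulgKV.
  by rewrite /s ce invMg mulgA mulgK; apply: s1E; [|rewrite -ce]; apply: cU.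
(* Across cosets the color modulo [L] is recovered from its two components: modulo [U] it is that of
   [s0], and the [f]-part reduces to [s1] on [U] because representatives have trivial component. *)
apply: (simq_f (groupM (sG h hG) (groupVr (sG g gG))) (groupM hG (groupVr gG))).
  apply: (simq_div abG srS sgU (s0G h hG) (s0G g gG)); rewrite ?sG ?s_coset //.
  exact/(simqS sLU)/s0E.
have [hu gu] := (cU h, cU g).
rewrite fD ?sG // !fs // -fD ?inUG ?s1U //.
rewrite (fD hG gG) (fu h hG) (fu g gG) -fD ?(inUG hu) ?(inUG gu) //.
by apply/f_simq/sim_simq/s1E.
Qed.

End RightSplit.

End Wreath.

(** * Schurity of the wreath product in both cases *)

Theorem theorem7p5 (gT : finGroupType) (G U L : {group gT}) (S : {set {set gT}})
    (cycG : cyclic G) (srS : sring G S) (secUL : sring_section S U L)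
    (wrS : is_wreath G S U L)
    (decomp :
      cayley_isomorphic U (sring_sub S U)
        (setX_group L (U / L)) (sring_tensor (sring_sub S L) (sring_quo S U L))
      \/
      cayley_isomorphic (G / L) (sring_quo S G L)
        (setX_group (U / L) (G / U))
        (sring_tensor (sring_quo S U L) (sring_quo S G U))) :
  schurian G S <->
    schurian U (sring_sub S U) /\ schurian (G / L) (sring_quo S G L).
Proof.
have abG := cyclic_abelian cycG; have [sgU sgL sLU] := secUL.
have sUG := sring_group_sub srS sgU; have sLG := sring_group_sub srS sgL.
have pS := sring_partition srS; have sgG := sring_group_full srS.
split=> [schS|[schU schQ]].
  by split; [apply: schurian_sub sgU schS | apply: schurian_quo sgL schS].
case: decomp => dec.
  have [f [fM fUL fL1 f_sim sim_f]] := tensor_iso (cyclicS sUG cycG) sLU (erefl _)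
    (sring_sub_partition srS sgU) dec.
  apply: (schurian_left_split abG srS sgU sgL sLU wrS schU schQ fM fUL fL1).
    move=> a b aU ab; have := f_sim a b.
    rewrite (sim_subE srS sgU) (sim_subE srS sgL) aU => /(_ ab).
    by case/andP.
  move=> a b aU bU /exists_inP[l lL ab] fab; have := sim_f a b l aU bU lL.
  rewrite !(sim_subE srS sgU) (sim_subE srS sgL) aU fab andbT; apply=> //.
  exact: subsetP fUL _ (imset_f f aU).
have sKA : U / L \subset G / L by apply: quotientS.
have [f [fM fUL fL1 f_sim sim_f]] := tensor_iso (quotient_cyclic L cycG) sKA (erefl _)
  (sring_quo_partition abG srS sgG sgL) dec.
have nLG := subsetP (sring_abelian_norm abG srS sgL).
have f1 : f 1 = 1 by apply: (mulgI (f 1)); rewrite -fM ?mulg1.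
apply: (@schurian_right_split _ G U L S abG srS sgU sgL sLU wrS schU schQ _
  (f \o coset L) (sim (sring_quo S U L))).
- by move=> a b aG bG; rewrite /= morphM ?nLG // fM ?mem_quotient.
- by move=> l lL; rewrite /= coset_id.
(* [f] is injective on [U / L] with values in [U / L], hence onto it, so every component occurs on
   [U]. *)
- move=> g gG; have injf : {in U / L &, injective f}.
    move=> a c aK cK e; apply/eqP; rewrite eq_mulgV1; apply/eqP/fL1.
      by rewrite groupM ?groupV.
    apply: (mulIg (f c)); rewrite -fM ?groupM ?groupV ?(subsetP sKA) //.
    by rewrite mulgKV mul1g.
  have fKE : f @: (U / L) = U / L.
    apply/eqP; rewrite eqEcard (card_in_imset injf) leqnn andbT.
    exact: subset_trans (imsetS f sKA) fUL.
  have : f (coset L g) \in f @: (U / L).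
    by rewrite fKE; apply: (subsetP fUL); apply/imset_f/mem_quotient.
  by case/imsetP=> _ /morphimP[u _ uU ->] e; exists u.
- move=> a b ab; apply: f_sim; rewrite (sim_quoE abG srS sgG sgL) //;
  by case: (simq_in srS sgL ab).
move=> a b aG bG /exists_inP[u uU ab] fab.
have uG := subsetP sUG u uU.
rewrite -(sim_quoE abG srS sgG sgL) //.
(* Being related modulo [U] in [G] means being related in [G / L] up to the factor [coset L u] of
   [U / L]. *)
apply: (sim_f _ _ (coset L u)) fab; rewrite ?mem_quotient //.
by rewrite -morphM ?nLG // (sim_quoE abG srS sgG sgL) ?groupM // sim_simq.
Qed.
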